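(* Let $(\Omega,\mathcal A,\mu)$ be a $\sigma$-finite measure space, $K\in(0,\mu(\Omega))$ and $\rho>0$. Let $X$ be a reflexive Banach space that is compactly and densely embedded in $L^1(\Omega)$, and let $f:X\to\mathbb R$ be lower semicontinuous, convex, bounded from below, coercive and Gateaux-differentiable. Let $u^*\in X$ be a local minimum or a strongly critical point of the penalized problem $$\min_{u\in X}f(u)+\rho\,(\|u\|_1-|u|_K).$$ Let $A\in\mathcal A$ with $A\subseteq\operatorname{supp}u^*$ be such that $\mu(A)\le K$ and $\int_A|u^*|\,d\mu=|u^*|_K$. Then: (1) $f'(u^* )\in L^\infty(\Omega)$; (2) $f'(u^* )(x)=0$ for almost every $x\in\operatorname{supp}u^*\cap A$; (3) $f'(u^* )(x)=-\rho\operatorname{sign}(u^* )(x)$ for almost every $x\in\operatorname{supp}u^*\setminus A$; (4) $|f'(u^* )(x)|\le\rho$ for almost every $x\notin\operatorname{supp}u^*$. In addition, $A$ is unique up to sets of measure zero: if $B\in\mathcal A$, $B\subseteq\operatorname{supp}u^*$, satisfies $\mu(B)\le K$ and $\int_B|u^*|\,d\mu=|u^*|_K$, then $\mu(A\triangle B)=0$, where $A\triangle B$ is the symmetric difference.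
   Context: $\operatorname{supp}u:=\{x\in\Omega\mid u(x)\ne0\}$. The largest-$K$-norm is $|u|_K:=\sup_{A\in\mathcal A:\ \mu(A)\le K}\int_A|u|\,d\mu$; $\|u\|_1$ is the $L^1(\Omega)$-norm. $f$ is coercive if $\|u_n\|_X\to\infty$ implies $f(u_n)\to\infty$. The convex subdifferential of $\phi$ on $X$ is $\partial\phi(u)=\{s\in X'\mid\phi(v)-\phi(u)\ge\langle s,v-u\rangle\ \forall v\in X\}$. A point $u^*$ is a strongly critical point of the penalized problem if, with $g:=f+\rho\|\cdot\|_1$ and $h:=\rho|\cdot|_K$ on $X$, one has $\emptyset\ne\partial h(u^* )\subseteq\partial g(u^* )$. The statement $f'(u^* )\in L^\infty(\Omega)$ means that $f'(u^* )\in X'$ extends (uniquely, by density) to a continuous linear functional on $L^1(\Omega)$ and is identified with its representative in $L^\infty(\Omega)=L^1(\Omega)'$, i.e. $\langle f'(u^* ),v\rangle=\int_\Omega f'(u^* )\,v\,d\mu$ for $v\in X$. *)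

(* Defs.v *)
From HB Require Import structures.
From mathcomp Require Import all_boot all_order all_algebra.
From mathcomp Require Import all_classical all_reals all_analysis.

Set Implicit Arguments.
Unset Strict Implicit.
Unset Printing Implicit Defensive.
Import Order.TTheory GRing.Theory Num.Theory.
Import numFieldNormedType.Exports.

Local Open Scope classical_set_scope.
Local Open Scope ring_scope.

Section Banach.
Context {R : realType} {X : normedModType R}.
Implicit Types (f phi : X -> R) (s : X -> R) (u v : X).

Definition dual : set (X -> R) := [set s : X -> R | scalar s /\ continuous s].

Definition dual_norm s : R := sup [set `|s u| | u in [set u | `|u| <= 1]].

(* A functional Phi on the dual is an arbitrary function on X -> R, of which
   only the restriction to [dual] matters. *)
Definition bidual (Phi : (X -> R) -> R) : Prop :=
  (forall (a : R) s t, dual s -> dual t ->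
     Phi (fun v => a * s v + t v) = a * Phi s + Phi t) /\
  (exists C : R, forall s, dual s -> `|Phi s| <= C * dual_norm s).

Definition reflexive_space : Prop :=
  forall Phi, bidual Phi -> exists u : X, forall s, dual s -> Phi s = s u.

Definition coercive f : Prop :=
  forall u_ : nat -> X,
    `|u_ n| @[n --> \oo] --> +oo -> f (u_ n) @[n --> \oo] --> +oo.

Definition gateaux_deriv f u : X -> R := fun v => 'D_v f u.

Definition gateaux_differentiable f : Prop :=
  forall u, (forall v, derivable f u v) /\ dual (gateaux_deriv f u).

Definition subdifferential phi u : set (X -> R) :=
  [set s | dual s /\ forall v, s (v - u) <= phi v - phi u].

Definition local_min phi u : Prop := \forall v \near u, phi u <= phi v.

Definition strongly_critical (g h : X -> R) u : Prop :=
  subdifferential h u !=set0 /\ subdifferential h u `<=` subdifferential g u.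

End Banach.
Arguments dual {R} X.
Arguments reflexive_space {R} X.

Section L1.
Context d {T : measurableType d} {R : realType}.
Variable mu : {measure set T -> \bar R}.
Implicit Types w : T -> R.

Definition supp w : set T := [set x | w x != 0].

Definition L1norm w : R := fine ('N[mu]_1[EFin \o w])%E.

(* Finite for integrable w: the set is nonempty (take set0) and bounded by
   L1norm w. *)
Definition largestK (K : R) w : R :=
  sup [set \int[mu]_(x in A) `|w x| |
       A in [set A | measurable A /\ (mu A <= K%:E)%E]].

Section embedding.
Context {X : normedModType R} (iota : X -> LspaceType1 mu).

(* LspaceType1 is a quotient without module structure in the library, so the
   vector space operations and the norm are taken on representatives. *)
Record compact_dense_embedding : Prop := {
  embedding_linear : forall (a : R) (u v : X),
    iota (a *: u + v) = (fun x => a * iota u x + iota v x) %[ae mu] ;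
  embedding_inj : injective iota ;
  embedding_continuous : exists C : R, forall u, L1norm (iota u) <= C * `|u| ;
  embedding_compact : forall u_ : nat -> X,
    (exists M : R, forall n, `|u_ n| <= M) ->
    exists (k : nat -> nat) (g : LspaceType1 mu),
      {homo k : m n / (m < n)%N} /\
      L1norm (iota (u_ (k n)) \- g) @[n --> \oo] --> (0 : R) ;
  embedding_dense : forall (g : LspaceType1 mu) (e : R), 0 < e ->
    exists u, L1norm (iota u \- g) < e }.

(* xi is a function in L^oo through which the functional s on X, extended to
   L^1, is represented *)
Definition Linfty_representative (s : X -> R) (xi : T -> R) : Prop :=
  xi \in Lfun mu +oo%E /\
  forall v, s v = \int[mu]_x (xi x * iota v x).

End embedding.
End L1.

(* Main.v *)
(** Along [u + t z], [t] decreasing to [0], both hypotheses on [ustar] yield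
    [s z <= f' z + rho * (norm)' z] for every subgradient [s] of
    [rho * largestK]: a local minimum dominates the difference of the two convex
    terms to first order, and a strongly critical point does so globally.
    Applied to the subgradient [s v = rho * \int_A sgn(w) v] and to both [z] and
    [- z], this says that [l := f' - s + rho * \int sgn(w) _] satisfies
    [|l z| <= rho * \int_{w = 0} |z|].  Such an [l] extends by density to [L^1]
    and is represented by some [xi0] with [|xi0| <= rho * 1_{w = 0}], so that
    [f'] is represented by [xi0 - rho * sgn(w) * 1_{~ A}]; the pointwise claims
    are read off this formula.  Density also makes the representative unique,
    so the formulas for two maximizers [A] and [B] must agree, which forces
    [A = B] almost everywhere. *)

Require Import Defs.
From HB Require Import structures.
From mathcomp Require Import all_boot all_order all_algebra.
From mathcomp Require Import all_classical all_reals all_analysis.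
From mathcomp Require Import measurable_realfun ess_sup_inf ring lra.

Set Implicit Arguments.
Unset Strict Implicit.
Unset Printing Implicit Defensive.
Import Order.TTheory GRing.Theory Num.Theory.
Import numFieldNormedType.Exports.

Local Open Scope classical_set_scope.
Local Open Scope ring_scope.

(** * Real-valued integrable functions *)

Section real_integral.
Context d (T : measurableType d) (R : realType).
Variable mu : {measure set T -> \bar R}.
Implicit Types g h : T -> R.

Local Notation intble g := (mu.-integrable [set: T] (EFin \o g)).

Lemma integrable_EFin_measurable g : intble g -> measurable_fun [set: T] g.
Proof. by move=> /measurable_int /measurable_EFinP. Qed.

Lemma integrable_EFin_D g h : intble g -> intble h -> intble (fun x => g x + h x).
Proof. by move=> ig ih; have := integrableD measurableT ig ih. Qed.

Lemma integrable_EFin_B g h : intble g -> intble h -> intble (fun x => g x - h x).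
Proof. by move=> ig ih; have := integrableB measurableT ig ih. Qed.

Lemma integrable_EFin_Z a g : intble g -> intble (fun x => a * g x).
Proof. by move=> ig; have := integrableZl measurableT a ig. Qed.

Lemma integrable_EFin_dominated g h : measurable_fun [set: T] g -> intble h ->
  (forall x, `|g x| <= h x) -> intble g.
Proof.
move=> mg ih gh; apply: (le_integrable measurableT _ _ ih).
  exact/measurable_EFinP.
by move=> x _ /=; rewrite lee_fin (le_trans (gh x)) ?ler_norm.
Qed.

Lemma integrable_EFin_bounded_mul C h g : measurable_fun [set: T] h ->
  (forall x, `|h x| <= C) -> intble g -> intble (fun x => h x * g x).
Proof.
move=> mh hC ig.
apply: (@integrable_EFin_dominated _ (fun x => C * `|g x|)).
- by apply: measurable_funM => //; exact: integrable_EFin_measurable.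
- by apply: integrable_EFin_Z; exact: integrable_norm ig.
- by move=> x; rewrite normrM ler_wpM2r.
Qed.

Lemma integrable_indic_mul B g : measurable B -> intble g ->
  intble (fun x => \1_B x * g x).
Proof.
move=> mB ig; apply: (@integrable_EFin_bounded_mul 1 (\1_B) g) => //.
by move=> x; rewrite indicE normr_nat lern1 leq_b1.
Qed.

Lemma Rintegral_dominated_cvg (g_ : nat -> T -> R) g h :
  (forall n, measurable_fun [set: T] (g_ n)) -> measurable_fun [set: T] g ->
  (forall x, g_ n x @[n --> \oo] --> g x) -> intble h ->
  (forall n x, `|g_ n x| <= h x) ->
  [/\ intble g, \int[mu]_x `|g_ n x - g x| @[n --> \oo] --> (0 : R) &
      \int[mu]_x g_ n x @[n --> \oo] --> \int[mu]_x g x].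
Proof.
move=> mg_ mg g_g ih g_h.
have [] := @dominated_convergence _ _ _ mu _ measurableT
  (fun n => EFin \o g_ n) (EFin \o g) (EFin \o h).
- by move=> n; exact/measurable_EFinP.
- exact/measurable_EFinP.
- by apply: aeW => x _; apply: cvg_EFin; [exact: nearW|exact: g_g].
- exact: ih.
- by apply: aeW => x n _; rewrite /= lee_fin.
move=> ig cv1 cv2; split => //.
- rewrite -[0]/(fine 0%:E); apply: fine_cvg.
  exact: cv1.
- apply: fine_cvg; rewrite fineK; first exact: cv2.
  exact: integrable_fin_num ig.
Qed.

End real_integral.

(** The function is a weighted sum of indicators of a cover by sets of finite measure. It replaces
    the constant 1, which need not be integrable, as a strictly positive weight in the Radon-Nikodym
    and uniqueness arguments. *)
Lemma sigma_finite_positive_integrable d (T : measurableType d) (R : realType)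
    (mu : {sigma_finite_measure set T -> \bar R}) :
  exists phi : T -> R, [/\ measurable_fun [set: T] phi, forall x, 0 < phi x &
    mu.-integrable [set: T] (EFin \o phi)].
Proof.
have [F TF /all_and2[mF muF]] := sigma_finiteT mu.
(* Dividing by [1 + fine (mu (F i))] bounds both [c i] and [c i * fine (mu (F i))] by the [i]-th
   term of a series with sum at most [2^-1]: the first bound makes the sum finite at every point,
   the second makes it integrable. *)
pose c i : R := 2^-1 / (2 ^ i.+1)%:R / (1 + fine (mu (F i))).
have muF0 i : 0 <= fine (mu (F i)) by rewrite fine_ge0.
have c_gt0 i : 0 < c i.
  by rewrite /c !divr_gt0 ?invr_gt0 ?ltr0n ?expn_gt0// ltr_pwDl.
pose f i x : \bar R := (c i * \1_(F i) x)%:E.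
have f_ge0 i x : (0 <= f i x)%E by rewrite lee_fin mulr_ge0// ltW.
have mf i : measurable_fun [set: T] (f i).
  by apply/measurable_EFinP; apply: measurable_funM => //; exact: measurable_indic.
pose S x : \bar R := (\sum_(i <oo) f i x)%E.
have S_le x : (S x <= 2^-1%:E)%E.
  apply: le_trans (epsilon_trick0 (fun=> true) _); last by rewrite invr_ge0.
  apply: lee_nneseries => // i _; rewrite lee_fin /c indicE.
  rewrite -[leLHS]mulrA ler_piMr ?divr_ge0//.
  have [|] := boolP (x \in F i); rewrite ?mulr0// mulr1 => _.
  by rewrite invf_le1 ?lerDl// ltr_pwDl.
have S_ge0 x : (0 <= S x)%E by apply: nneseries_ge0.
have S_fin x : S x \is a fin_num.
  by rewrite ge0_fin_numE// (le_lt_trans (S_le x))// ltry.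
exists (fine \o S).
have SE : EFin \o (fine \o S) = S by apply/funext => x /=; rewrite fineK.
have mS : measurable_fun [set: T] S by exact: ge0_emeasurable_sum.
split.
- by apply/measurable_EFinP; rewrite SE.
- move=> x /=; rewrite fine_gt0// (le_lt_trans (S_le x)) ?ltry// andbT.
  have [i _ Fix] : (\bigcup_i F i) x by rewrite -TF.
  have fi0 : (0 < f i x)%E by rewrite lte_fin indicE mem_set// mulr1.
  apply: (lt_le_trans fi0).
  rewrite /S (nneseries_split 0 i.+1)//.
  rewrite big_nat_recr//= -[leLHS]adde0 leeD//; last exact: nneseries_ge0.
  by rewrite leeDr// sume_ge0.
- rewrite SE; apply/integrableP; split => //.
  under eq_integral do rewrite gee0_abs//.
  rewrite integral_nneseries//.
  apply: (@le_lt_trans _ _ (2^-1)%:E); last exact: ltry.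
  apply: le_trans (epsilon_trick0 (fun=> true) _); last by rewrite invr_ge0.
  apply: lee_nneseries => [i _ _|i _]; first by apply: integral_ge0 => x _; exact: f_ge0.
  under eq_integral do rewrite /f EFinM.
  rewrite ge0_integralZl//; last 2 first.
  - exact/measurable_EFinP/measurable_indic.
  - by rewrite lee_fin ltW.
  rewrite integral_indic// setIT -[X in (_ * X)%E]fineK; last first.
    by rewrite ge0_fin_numE//; exact: muF.
  rewrite -EFinM lee_fin.
  rewrite /c -[leLHS]mulrA ler_piMr// ?divr_ge0//.
  by rewrite mulrC ler_pdivrMr ?mul1r ?lerDr// ltr_pwDl.
Qed.

Lemma measurable_set_lt d (T : measurableType d) (R : realType) (g h : T -> R) :
  measurable_fun [set: T] g -> measurable_fun [set: T] h ->
  measurable [set x | g x < h x].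
Proof.
move=> mg mh; rewrite -[X in measurable X]setTI.
by apply: (measurable_fun_ltr mg mh measurableT (Y := [set true])).
Qed.

Lemma measurable_fun_inv_gt0 d (T : measurableType d) (R : realType) (g : T -> R) :
  measurable_fun [set: T] g -> (forall x, 0 < g x) ->
  measurable_fun [set: T] (fun x => (g x)^-1).
Proof.
move=> mg g_gt0.
have -> : (fun x => (g x)^-1) = (@powR R ^~ (-1)) \o g.
  by apply/funext => x /=; rewrite powR_inv1// ltW.
exact: (measurableT_comp (measurable_powR _) mg).
Qed.

Lemma Rintegral_eq0_ae d (T : measurableType d) (R : realType)
    (mu : {measure set T -> \bar R}) (g : T -> R) :
  mu.-integrable [set: T] (EFin \o g) -> (forall x, 0 <= g x) ->
  \int[mu]_x g x = 0 -> {ae mu, forall x, g x = 0}.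
Proof.
move=> ig g0 intg0.
have mg := measurable_int _ ig.
have : (\int[mu]_x `|(EFin \o g) x| = 0)%E.
  under eq_integral do rewrite gee0_abs ?lee_fin//.
  by rewrite -[LHS]fineK ?(integrable_fin_num _ ig)// -/(Rintegral _ _ _) intg0.
move/(ae_eq_integral_abs mu measurableT mg).1.
by apply: filterS => x /(_ I) [].
Qed.

(** The test set is [[set x | h x < g x]]: there [g - h] is positive, yet its integral is at most 0,
    so the set is negligible. *)
Lemma ae_le_Rintegral_indic d (T : measurableType d) (R : realType)
    (mu : {measure set T -> \bar R}) (g h : T -> R) :
  mu.-integrable [set: T] (EFin \o g) -> mu.-integrable [set: T] (EFin \o h) ->
  (forall B, measurable B ->
    \int[mu]_x (\1_B x * g x) <= \int[mu]_x (\1_B x * h x)) ->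
  {ae mu, forall x, g x <= h x}.
Proof.
move=> ig ih gh.
pose B := [set x | h x < g x].
have mB : measurable B.
  exact: measurable_set_lt (integrable_EFin_measurable ih)
    (integrable_EFin_measurable ig).
have iBg := integrable_indic_mul mB ig.
have iBh := integrable_indic_mul mB ih.
have diff_ge0 x : 0 <= \1_B x * g x - \1_B x * h x.
  rewrite indicE; case: (boolP (x \in B)) => [|_]; last by rewrite !mul0r subrr.
  by rewrite inE /B/= !mul1r subr_ge0 => /ltW.
have : {ae mu, forall x, \1_B x * g x - \1_B x * h x = 0}.
  apply: Rintegral_eq0_ae => //; first exact: integrable_EFin_B.
  apply/eqP; rewrite eq_le Rintegral_ge0 => [|x _]; last exact: diff_ge0.
  by rewrite andbT RintegralB// subr_le0 gh.
apply: filterS => x; rewrite indicE; case: (boolP (x \in B)) => [_|].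
  by rewrite !mul1r => /eqP; rewrite subr_eq0 => /eqP ->.
by rewrite notin_setE /B/= => /negP; rewrite -leNgt.
Qed.

(** * Bounded linear functionals on L^1 *)

Section L1_functional.
Context d (T : measurableType d) (R : realType).
Variable mu : {measure set T -> \bar R}.
Local Notation intble g := (mu.-integrable [set: T] (EFin \o g)).

Variables (F : (T -> R) -> R) (C : R).
Hypothesis F_linear : forall a g h, intble g -> intble h ->
  F (fun x => a * g x + h x) = a * F g + F h.
Hypothesis F_bounded : forall g, intble g -> `|F g| <= C * \int[mu]_x `|g x|.

Lemma L1_functional0 : F (fun=> 0) = 0.
Proof.
have i0 : intble (fun=> 0 : R) by exact: integrable0.
have := F_linear 1 i0 i0.
have -> : (fun _ : T => 1 * 0 + 0) = fun=> 0 :> R.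
  by apply/funext => x; rewrite mulr0 addr0.
by rewrite mul1r => /eqP; rewrite -subr_eq0 opprD addNKr oppr_eq0 => /eqP.
Qed.

Lemma L1_functionalD g h : intble g -> intble h ->
  F (fun x => g x + h x) = F g + F h.
Proof.
move=> ig ih; rewrite -[F g]mul1r -F_linear//; congr F.
by apply/funext => x; rewrite mul1r.
Qed.

Lemma L1_functionalZ a g : intble g -> F (fun x => a * g x) = a * F g.
Proof.
move=> ig; rewrite -[RHS]addr0 -L1_functional0 -F_linear//; last exact: integrable0.
by congr F; apply/funext => x; rewrite addr0.
Qed.

Lemma L1_functionalB g h : intble g -> intble h ->
  F (fun x => g x - h x) = F g - F h.
Proof.
move=> ig ih; rewrite addrC -mulN1r -F_linear//; congr F.
by apply/funext => x; rewrite mulN1r addrC.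
Qed.

Lemma L1_functional_sum I (r : seq I) (g : I -> T -> R) :
  (forall i, intble (g i)) ->
  intble (fun x => \sum_(i <- r) g i x) /\
  F (fun x => \sum_(i <- r) g i x) = \sum_(i <- r) F (g i).
Proof.
move=> ig; elim: r => [|i r [ir IH]].
  have -> : (fun x => \sum_(i <- [::]) g i x) = fun=> 0.
    by apply/funext => x; rewrite big_nil.
  by rewrite big_nil; split; [exact: integrable0|exact: L1_functional0].
have E : (fun x => \sum_(j <- i :: r) g j x) =
    (fun x => g i x + \sum_(j <- r) g j x).
  by apply/funext => x; rewrite big_cons.
rewrite E big_cons -IH; split; first exact: integrable_EFin_D.
exact: L1_functionalD.
Qed.

(** Dominated convergence yields convergence in the L^1 distance, for which [F] is Lipschitz. *)
Lemma L1_functional_cvg (g_ : nat -> T -> R) (g h : T -> R) :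
  (forall n, measurable_fun [set: T] (g_ n)) -> measurable_fun [set: T] g ->
  (forall x, g_ n x @[n --> \oo] --> g x) -> intble h ->
  (forall n x, `|g_ n x| <= h x) -> F (g_ n) @[n --> \oo] --> F g.
Proof.
move=> mg_ mg g_g ih g_h.
have [ig cvg0 _] := Rintegral_dominated_cvg mg_ mg g_g ih g_h.
have ig_ n : intble (g_ n) by exact: integrable_EFin_dominated ih (g_h n).
have cvgC : C * \int[mu]_x `|g_ n x - g x| @[n --> \oo] --> (0 : R).
  by rewrite -[0](mulr0 C); apply: cvgM => //; exact: cvg_cst.
apply/cvgrPdist_lt => e e0; move/cvgrPdist_lt/(_ e e0) : cvgC.
apply: filterS => n; rewrite sub0r normrN distrC -L1_functionalB//.
apply: le_lt_trans; apply: le_trans (ler_norm _).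
by apply: F_bounded; exact: integrable_EFin_B.
Qed.

(* The weight [phi] makes [\1_B * phi] integrable for every measurable [B], so
   that [B |-> F (\1_B * phi)] is a finite charge although [mu] may be infinite. *)
Section weight.
Import HBNNSimple.
Variable phi : T -> R.
Hypotheses (phi_gt0 : forall x, 0 < phi x) (iphi : intble phi).

Lemma L1_functional_sigma_additive :
  semi_sigma_additive (fun B => (F (fun x => \1_B x * phi x))%:E).
Proof.
move=> B mB tB mUB.
pose g_ n x := \sum_(i <- index_iota 0 n) \1_(B i) x * phi x.
(* By disjointness the indicators add up to the indicator of the union, so every partial sum is
   dominated by [phi]. *)
have gE n x : g_ n x = \1_(\bigcup_(i < n) B i) x * phi x.
  rewrite /g_ -mulr_suml; congr (_ * _).
  elim: n => [|n IH]; first by rewrite big_geq// bigcup_mkord big_ord0 indic0.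
  rewrite big_nat_recr//= IH !bigcup_mkord big_ord_recr/= !indicE in_setU.
  have tB' : trivIset (fun=> true) B by apply: sub_trivIset tB.
  have := @trivIset_bigsetUI _ xpredT B tB' n n isT (leqnn n).
  move/seteqP => [/(_ x) dis _].
  have [xU|] := boolP (x \in \big[setU/set0]_(i < n) B i);
    have [xB|] := boolP (x \in B n); rewrite ?addr0 ?add0r//=.
  by exfalso; apply: dis; split; exact: set_mem.
have -> : (fun n => \sum_(0 <= i < n) (F (fun x => \1_(B i) x * phi x))%:E)%E =
    (fun n => (F (g_ n))%:E).
  apply/funext => n; rewrite sumEFin; congr EFin.
  by rewrite (L1_functional_sum _ _).2// => i; exact: integrable_indic_mul.
apply: cvg_EFin; first exact: nearW.
apply: (@L1_functional_cvg g_ _ phi) => //.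
- move=> n; apply: integrable_EFin_measurable.
  by apply: (L1_functional_sum _ _).1 => i; exact: integrable_indic_mul.
- exact: integrable_EFin_measurable (integrable_indic_mul mUB iphi).
(* The sequence is stationary: a point of [B k] lies in all partial unions from index [k.+1] on, and
   a point outside the union lies in none. *)
- move=> x; have [[k _ Bkx]|nBx] := pselect ((\bigcup_k B k) x).
    apply: cvg_near_cst; near=> n; rewrite gE !indicE !mem_set//.
      by exists k.
    by exists k => //=; near: n; exists k.+1.
  apply: cvg_near_cst; apply: nearW => n; rewrite gE !indicE !memNset//.
  by move=> [i _ Bix]; apply: nBx; exists i.
- move=> n x; rewrite gE indicE normrM (gtr0_norm (phi_gt0 x)) normr_nat.
  apply: ler_piMl; first exact/ltW/phi_gt0.
  by rewrite lern1 leq_b1.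
Unshelve. all: by end_near. Qed.

(** For [g >= 0], simple functions [s n] increase to [g / phi]; each [s n * phi] is a finite
    combination of functions [\1_B * phi], and these products converge to [g] under the bound [g]. A
    general [g] is a difference of two nonnegative integrable functions. *)
Lemma L1_functional_eq0 :
  (forall B, measurable B -> F (fun x => \1_B x * phi x) = 0) ->
  forall g, intble g -> F g = 0.
Proof.
move=> F0.
have F0_ge0 g : intble g -> (forall x, 0 <= g x) -> F g = 0.
  move=> ig g0.
  have mphi := integrable_EFin_measurable iphi.
  have mg := integrable_EFin_measurable ig.
  pose q x := (g x / phi x)%:E.
  have mq : measurable_fun [set: T] q.
    apply/measurable_EFinP; apply: measurable_funM => //.
    exact: measurable_fun_inv_gt0.
  have q0 x : [set: T] x -> (0 <= q x)%E by rewrite lee_fin divr_ge0// ltW.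
  pose s := nnsfun_approx measurableT mq.
  have s_ge0 n x : 0 <= s n x by [].
  have s_le n x : s n x * phi x <= g x.
    rewrite -ler_pdivlMr// -lee_fin /s nnsfun_approxE.
    exact: (le_approx n q0).
  have cvg_F : F (fun x => s n x * phi x) @[n --> \oo] --> F g.
    apply: (@L1_functional_cvg _ _ g) => //.
    - by move=> n; apply: measurable_funM.
    - move=> x.
      have -> : g x = (g x / phi x) * phi x by rewrite divfK// gt_eqF.
      apply: cvgM; last exact: cvg_cst.
      have := cvg_nnsfun_approx measurableT mq q0 (Logic.I : [set: T] x).
      by move/fine_cvg.
    - by move=> n x; rewrite ger0_norm// mulr_ge0// ltW.
  suff Fs0 n : F (fun x => s n x * phi x) = 0.
    apply/esym/(cvg_unique _ _ cvg_F) => //.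
    have -> : (fun n => F (fun x => s n x * phi x)) = cst 0 by apply/funext.
    exact: cvg_cst.
  have -> : (fun x => s n x * phi x) =
      (fun x => \sum_(y <- finmap.enum_fset (fset_set (range (s n))))
        y * (\1_(s n @^-1` [set y]) x * phi x)).
    apply/funext => x; rewrite fimfunE fsbig_finite//= mulr_suml.
    by apply: eq_bigr => y _; rewrite mulrA.
  rewrite (L1_functional_sum _ _).2//.
    rewrite big1// => y _; rewrite L1_functionalZ ?F0 ?mulr0//.
    exact: integrable_indic_mul.
  by move=> y; apply: integrable_EFin_Z; exact: integrable_indic_mul.
move=> g ig.
have ing := integrable_norm ig.
have -> : g = (fun x => `|g x| - (`|g x| - g x)) by apply/funext => x; rewrite subKr.
rewrite L1_functionalB//; last exact: integrable_EFin_B.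
rewrite !F0_ge0 ?subrr//.
- exact: integrable_EFin_B.
- by move=> x; rewrite subr_ge0 ler_norm.
Qed.

End weight.
End L1_functional.

(** * Radon-Nikodym representation of functionals with a weighted bound *)

Lemma ae_eq_Rintegral d (T : measurableType d) (R : realType)
    (mu : {measure set T -> \bar R}) (g h : T -> R) :
  measurable_fun [set: T] g -> measurable_fun [set: T] h ->
  {ae mu, forall x, g x = h x} -> \int[mu]_x g x = \int[mu]_x h x.
Proof.
move=> mg mh gh; congr fine; apply: ae_eq_integral => //.
- exact/measurable_EFinP.
- exact/measurable_EFinP.
- by apply: filterS gh => x -> _.
Qed.

Lemma Rintegral_indic_mul d (T : measurableType d) (R : realType)
    (mu : {measure set T -> \bar R}) (B : set T) (g : T -> R) :
  \int[mu]_x (\1_B x * g x) = \int[mu]_(x in B) g x.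
Proof.
rewrite [RHS]Rintegral_mkcond; apply: eq_Rintegral => x _.
by rewrite patch_indic mulrC.
Qed.

(** The charge [B |-> F (\1_B * phi)] is dominated by [mu], hence has a density [eta], and
    [eta / phi] represents [F]. Keeping a pointwise weight [c] in the bound, instead of a constant,
    lets the representative inherit the place where [c] vanishes. *)
Lemma L1_functional_representation d (T : measurableType d) (R : realType)
    (mu : {sigma_finite_measure set T -> \bar R}) (F : (T -> R) -> R)
    (c : T -> R) (C : R) :
  measurable_fun [set: T] c -> (forall x, 0 <= c x <= C) ->
  (forall a g h, mu.-integrable [set: T] (EFin \o g) ->
    mu.-integrable [set: T] (EFin \o h) ->
    F (fun x => a * g x + h x) = a * F g + F h) ->
  (forall g, mu.-integrable [set: T] (EFin \o g) ->
    `|F g| <= \int[mu]_x (c x * `|g x|)) ->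
  exists xi : T -> R, [/\ measurable_fun [set: T] xi,
    forall x, `|xi x| <= c x &
    forall g, mu.-integrable [set: T] (EFin \o g) ->
      F g = \int[mu]_x (xi x * g x)].
Proof.
move=> mc cC F_linear F_le.
have c_ge0 x : 0 <= c x by have /andP[] := cC x.
have c_norm x : `|c x| <= C by rewrite ger0_norm//; have /andP[] := cC x.
have F_bounded (g : T -> R) : mu.-integrable [set: T] (EFin \o g) ->
    `|F g| <= C * \int[mu]_x `|g x|.
  move=> ig; have ing := integrable_norm ig.
  rewrite -RintegralZl//; apply: le_trans (F_le _ ig) _.
  apply: le_Rintegral => //.
  - exact: integrable_EFin_bounded_mul mc c_norm ing.
  - exact: integrable_EFin_Z.
  - by move=> x _; rewrite ler_wpM2r//; have /andP[] := cC x.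
have [phi [mphi phi_gt0 iphi]] := sigma_finite_positive_integrable mu.
have i1phi B (mB : measurable B) := integrable_indic_mul mB iphi.
pose nu B : \bar R := (F (fun x => \1_B x * phi x))%:E.
have F_null B : measurable B -> mu B = 0%E -> F (fun x => \1_B x * phi x) = 0.
  move=> mB muB0; apply/eqP; rewrite -normr_le0.
  apply: le_trans (F_bounded _ (i1phi B mB)) _.
  have -> : \int[mu]_x `|\1_B x * phi x| = \int[mu]_(x in B) phi x.
    rewrite -[RHS]Rintegral_indic_mul; apply: eq_Rintegral => x _.
    by rewrite normrM indicE normr_nat gtr0_norm.
  rewrite /Rintegral null_set_integral ?mulr0//.
  by apply: measurable_funTS; exact: measurable_int iphi.
have nu0 : nu set0 = 0%E by rewrite /nu F_null.
have nu_fin B : measurable B -> nu B \is a fin_num by [].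
have nu_sigma : semi_sigma_additive nu.
  exact: (L1_functional_sigma_additive F_linear F_bounded phi_gt0 iphi).
pose nu_charge := isCharge.Build d T R nu nu0 nu_fin nu_sigma.
pose nuc : {charge set T -> \bar R} := HB.pack nu nu_charge.
have nu_mu : nuc `<< mu.
  by apply/null_content_dominatesP => B mB muB0; rewrite /= /nu F_null.
pose eta x := fine (Radon_Nikodym nuc mu x).
have etaE : EFin \o eta = Radon_Nikodym nuc mu.
  by apply/funext => x /=; rewrite fineK// Radon_Nikodym_fin_num.
have ieta : mu.-integrable [set: T] (EFin \o eta).
  by rewrite etaE; exact: Radon_Nikodym_integrable.
have FE B : measurable B ->
    F (fun x => \1_B x * phi x) = \int[mu]_x (\1_B x * eta x).
  move=> mB; rewrite Rintegral_indic_mul.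
  have := Radon_Nikodym_integral nu_mu mB.
  by rewrite /= -etaE /nu => /(congr1 fine).
have icphi := integrable_EFin_bounded_mul mc c_norm iphi.
have F_le_indic B : measurable B ->
    `|F (fun x => \1_B x * phi x)| <= \int[mu]_x (\1_B x * (c x * phi x)).
  move=> mB; apply: le_trans (F_le _ (i1phi B mB)) _.
  rewrite le_eqVlt; apply/orP; left; apply/eqP; apply: eq_Rintegral => x _.
  by rewrite normrM indicE normr_nat gtr0_norm// mulrCA.
(* The weighted bound on the functions [\1_B * phi], read for [F] and for its opposite, gives
   [|eta| <= c * phi] almost everywhere. *)
have eta_le : {ae mu, forall x, eta x <= c x * phi x}.
  apply: ae_le_Rintegral_indic => // B mB; rewrite -FE//.
  exact: le_trans (ler_norm _) (F_le_indic B mB).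
have eta_ge : {ae mu, forall x, -1 * eta x <= c x * phi x}.
  apply: ae_le_Rintegral_indic => //; first exact: integrable_EFin_Z.
  move=> B mB.
  under eq_Rintegral do rewrite mulrCA.
  rewrite RintegralZl//; last exact: integrable_indic_mul.
  rewrite mulN1r -FE//; apply: le_trans (F_le_indic B mB).
  by rewrite -normrN ler_norm.
have meta := integrable_EFin_measurable ieta.
(* Truncating to [[- c x, c x]] makes the bound hold at every point and changes [eta / phi] only on
   a null set. *)
pose xi x := Num.max (- c x) (Num.min (c x) (eta x / phi x)).
have mxi : measurable_fun [set: T] xi.
  apply: measurable_maxr; first exact: measurableT_comp.
  apply: measurable_minr => //; apply: measurable_funM => //.
  exact: measurable_fun_inv_gt0.
have xi_le x : `|xi x| <= c x.
  rewrite ler_norml /xi le_max lexx/= ge_max.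
  by rewrite (le_trans _ (c_ge0 x)) ?oppr_le0//= ge_min lexx.
have xi_norm x : `|xi x| <= C.
  by apply: le_trans (xi_le x) _; have /andP[] := cC x.
have xiE : {ae mu, forall x, xi x * phi x = eta x}.
  apply: filterS2 eta_le eta_ge => x le1 le2; rewrite /xi.
  rewrite min_r; last by rewrite ler_pdivrMr.
  rewrite max_r; last by rewrite ler_pdivlMr// mulNr lerNl -mulN1r.
  by rewrite divfK// gt_eqF.
have ixi (g : T -> R) (ig : mu.-integrable [set: T] (EFin \o g)) :=
  integrable_EFin_bounded_mul mxi xi_norm ig.
exists xi; split => // g ig; apply/eqP; rewrite -subr_eq0; apply/eqP.
(* The error functional is bounded on L^1, with one [C] from [F] and one from [xi], and vanishes on
   every [\1_B * phi]; hence it vanishes identically. *)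
pose G (g : T -> R) := F g - \int[mu]_x (xi x * g x).
apply: (@L1_functional_eq0 _ _ _ mu G (C + C) _ _ phi _ iphi) => //.
- move=> a u v iu iv; rewrite /G F_linear//.
  under eq_Rintegral do rewrite mulrDr mulrCA.
  rewrite RintegralD//; last 2 first.
  - exact/integrable_EFin_Z/ixi.
  - exact: ixi.
  by rewrite RintegralZl ?ixi//; ring.
- move=> u iu; rewrite /G mulrDl; apply: le_trans (ler_normB _ _) _.
  rewrite lerD ?F_bounded//.
  apply: le_trans (le_normr_Rintegral measurableT (ixi _ iu)) _.
  rewrite -RintegralZl//; last exact: integrable_norm iu.
  apply: le_Rintegral => //.
  - exact: integrable_norm (ixi _ iu).
  - exact/integrable_EFin_Z/(integrable_norm iu).
  - by move=> x _; rewrite normrM ler_wpM2r.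
- move=> B mB; rewrite /G FE//; apply/eqP; rewrite subr_eq0; apply/eqP.
  apply: ae_eq_Rintegral.
  - by apply: measurable_funM => //; exact: measurable_indic.
  - by apply: measurable_funM => //; apply: measurable_funM.
  - by apply: filterS xiE => x <-; rewrite mulrCA.
Qed.

Lemma ler_mul_gt0P (R : realFieldType) (x y M : R) : 0 <= M ->
  (forall e, 0 < e -> x <= y + M * e) -> x <= y.
Proof.
move=> M0 xy; apply/ler_addgt0Pr => e e0.
have M1 : 0 < M + 1 by rewrite ltr_wpDl.
apply: le_trans (xy _ (divr_gt0 e0 M1)) _.
by rewrite lerD2l mulrA ler_pdivrMr//; nra.
Qed.

(** * Functionals on a densely embedded space *)

Section scalar_functional.
Context (R : pzRingType) (V : lmodType R) (s : V -> R).
Hypothesis s_lin : scalar s.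

Lemma scalar_functionalB u v : s (u - v) = s u - s v.
Proof. by rewrite addrC -scaleN1r s_lin mulN1r addrC. Qed.

Lemma scalar_functional0 : s 0 = 0.
Proof. by rewrite -(subrr 0) scalar_functionalB subrr. Qed.

Lemma scalar_functionalN v : s (- v) = - s v.
Proof. by rewrite -sub0r scalar_functionalB scalar_functional0 sub0r. Qed.

Lemma scalar_functionalZ a v : s (a *: v) = a * s v.
Proof. by rewrite -[a *: v]addr0 s_lin scalar_functional0 addr0. Qed.

End scalar_functional.

(** * Passing between functions and elements of L^1 and L^oo *)

Section L1_space.
Context d (T : measurableType d) (R : realType).
Variable mu : {measure set T -> \bar R}.
Local Notation intble g := (mu.-integrable [set: T] (EFin \o g)).

Lemma L1normE (w : T -> R) : L1norm mu w = \int[mu]_x `|w x|.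
Proof. by rewrite /L1norm Lnorm1. Qed.

Lemma LspaceType1_integrable (g : LspaceType1 mu) : intble g.
Proof.
have mg : measurable_fun [set: T] (g : T -> R).
  exact: (@measurable_funPT _ _ _ _ (repr (g : aeEqMfun _ mu))).
apply/integrableP; split; first exact/measurable_EFinP.
by have := @Lebesgue_finite _ _ _ _ _ _ g; rewrite /finite_norm Lnorm1.
Qed.

(** This lets density of the embedding, which speaks of classes, be applied to an explicit
    integrable function. *)
Lemma integrable_LspaceType1 (g : T -> R) : intble g ->
  exists G : LspaceType1 mu, {ae mu, forall x, G x = g x}.
Proof.
move=> ig.
have mg : measurable_fun [set: T] g by exact: integrable_EFin_measurable ig.
have mg' : @measurable_fun _ _ T (measurableTypeR R) [set: T] g by exact: mg.
pose g_mfun := isMeasurableFun.Build _ _ T (measurableTypeR R) g mg'.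
pose g' : {mfun T >-> measurableTypeR R} := HB.pack g g_mfun.
pose h : aeEqMfun (measurableTypeR R) mu := \pi_(aeEqMfun (measurableTypeR R) mu)%qT g'.
have hg : {ae mu, forall x, h x = g x}.
  have : (repr h == g' %[mod aeEqMfun (measurableTypeR R) mu])%qT by rewrite reprK.
  by rewrite eqmodE => /asboolP; apply: filterS => x /(_ Logic.I).
have mh : measurable_fun [set: T] (h : T -> R).
  exact: (@measurable_funPT _ _ _ _ (repr h)).
have fh : finite_norm mu 1%E h.
  rewrite /finite_norm Lnorm1.
  have -> : (\int[mu]_x `|(EFin \o h) x| = \int[mu]_x `|(EFin \o g) x|)%E.
    apply: ae_eq_integral => //; try by do 2 apply: measurableT_comp => //.
    by apply: filterS hg => x /= -> _.
  by have /integrableP[] := ig.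
pose G : LspaceType1 mu := HB.pack h (isFinLebesgue.Build _ _ _ mu _ (lexx 1%E) h fh).
by exists G.
Qed.

Lemma Lfun_infty_bounded (xi : T -> R) : (0 < mu [set: T])%E ->
  xi \in Lfun mu +oo%E ->
  measurable_fun [set: T] xi /\ exists M, {ae mu, forall x, `|xi x| <= M}.
Proof.
move=> mu0 /andP[]; rewrite !inE/= => mxi; rewrite /finite_norm unlock mu0.
move=> supxi; split => //.
have le_sup := ess_sup_ge mu (abse \o (EFin \o xi)).
have [M supM] : exists M : R, (ess_sup mu (abse \o (EFin \o xi)) <= M%:E)%E.
  case: (ess_sup _ _) supxi => [M _| |_]//; first by exists M.
  by exists 0; rewrite leNye.
exists M; apply: filterS le_sup => x xM; rewrite -lee_fin.
exact: le_trans xM supM.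
Qed.

Lemma bounded_Lfun_infty (xi : T -> R) (M : R) :
  measurable_fun [set: T] xi -> (forall x, `|xi x| <= M) ->
  xi \in Lfun mu +oo%E.
Proof.
move=> mxi xiM; apply/andP; rewrite !inE/=; split => //.
rewrite /finite_norm unlock; case: ifPn => // _.
apply: (@le_lt_trans _ _ M%:E); last exact: ltry.
by apply/ess_supP; apply: nearW => x /=; rewrite lee_fin.
Qed.

End L1_space.

(** * Extension by density and uniqueness of the representative *)

Section dense_embedding.
Context d (T : measurableType d) (R : realType).
Variables (mu : {sigma_finite_measure set T -> \bar R}).
Variables (X : normedModType R) (iota : X -> LspaceType1 mu).
Hypothesis iotaP : compact_dense_embedding iota.
Local Notation intble g := (mu.-integrable [set: T] (EFin \o g)).
Local Notation dist u g := (\int[mu]_x `|iota u x - g x|).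

Let iint u : intble (iota u) := LspaceType1_integrable (iota u).

Lemma embedding_linear_ae a u v :
  {ae mu, forall x, iota (a *: u + v) x = a * iota u x + iota v x}.
Proof. by apply: filterS (embedding_linear iotaP a u v) => x /(_ Logic.I). Qed.

Lemma embedding_dense_integrable g e : intble g -> 0 < e -> exists u, dist u g < e.
Proof.
move=> ig e0; have [G Gg] := integrable_LspaceType1 ig.
have [u] := embedding_dense iotaP G e0.
rewrite L1normE => ue; exists u.
rewrite (_ : dist u g = \int[mu]_x `|(iota u \- G) x|)//.
have iG := LspaceType1_integrable G.
apply: ae_eq_Rintegral.
- apply: measurableT_comp => //; apply: integrable_EFin_measurable.
  exact: integrable_EFin_B.
- apply: measurableT_comp => //; apply: integrable_EFin_measurable.
  exact: integrable_EFin_B.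
- by apply: filterS Gg => x /= ->.
Qed.

Let le_RintegralD (p q r : T -> R) : intble p -> intble q -> intble r ->
  (forall x, p x <= q x + r x) ->
  \int[mu]_x p x <= \int[mu]_x q x + \int[mu]_x r x.
Proof.
move=> ip iq ir pqr; rewrite -RintegralD//; apply: le_Rintegral => //.
exact: integrable_EFin_D.
Qed.

(** Since [c <= C], [l] is [C]-Lipschitz for the L^1 distance. Its extension [F] stays within
    [C * dist u g] of [l u], so linearity and the bound weighted by [c] pass from [l] to [F] by
    density. *)
Lemma functional_representation (l : X -> R) (c : T -> R) (C : R) :
  measurable_fun [set: T] c -> 0 <= C -> (forall x, 0 <= c x <= C) ->
  scalar l -> (forall u, `|l u| <= \int[mu]_x (c x * `|iota u x|)) ->
  exists xi : T -> R, [/\ measurable_fun [set: T] xi,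
    forall x, `|xi x| <= c x & forall u, l u = \int[mu]_x (xi x * iota u x)].
Proof.
move=> mc C0 cC l_lin l_le.
have c_norm x : `|c x| <= C by have /andP[c0 ?] := cC x; rewrite ger0_norm.
have ic (g : T -> R) (ig : intble g) :=
  integrable_EFin_bounded_mul mc c_norm (integrable_norm ig).
have idist u (g : T -> R) (ig : intble g) :=
  integrable_norm (integrable_EFin_B (iint u) ig).
have c_le (g : T -> R) : intble g -> \int[mu]_x (c x * `|g x|) <= C * \int[mu]_x `|g x|.
  move=> ig; rewrite -RintegralZl//; last exact: integrable_norm ig.
  apply: le_Rintegral => //; first exact: ic.
  - exact/integrable_EFin_Z/(integrable_norm ig).
  - by move=> x _; rewrite ler_wpM2r//; have /andP[] := cC x.
(* Every lower bound for the value at [g] lies below every upper bound; this makes the supremum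
   defining [F] finite and squeezes it around [l u]. *)
have l_dist u v g : intble g -> l v - C * dist v g <= l u + C * dist u g.
  move=> ig; rewrite lerBlDr -addrA -lerBlDl -(scalar_functionalB l_lin) -mulrDr.
  apply: le_trans (ler_norm _) _; apply: le_trans (l_le _) _.
  apply: le_trans (c_le _ (iint _)) _; rewrite ler_wpM2l//.
  have -> : \int[mu]_x `|iota (v - u) x| = \int[mu]_x `|iota v x - iota u x|.
    apply: ae_eq_Rintegral.
    - apply: measurableT_comp => //; exact: integrable_EFin_measurable (iint _).
    - apply: measurableT_comp => //.
      exact: integrable_EFin_measurable (integrable_EFin_B (iint _) (iint _)).
    - apply: filterS (embedding_linear_ae (-1) u v) => x.
      by rewrite scaleN1r addrC mulN1r addrC => ->; rewrite addrC.
  apply: le_RintegralD; [exact: idist|exact: idist|exact: idist|] => x.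
  have := ler_distD (g x) (iota v x) (iota u x).
  by rewrite (distrC (g x)) => /le_trans; apply; rewrite [leLHS]addrC.
(* the McShane extension of the C-Lipschitz functional [l] *)
pose F (g : T -> R) := sup [set l v - C * dist v g | v in [set: X]].
have F_dist u g : intble g -> `|F g - l u| <= C * dist u g.
  move=> ig; rewrite ler_distl; apply/andP; split.
    apply: ub_le_sup; last by exists u.
    by exists (l u + C * dist u g) => _ [v _ <-]; exact: l_dist.
  apply: sup_le_ub; first by exists (l u - C * dist u g), u.
  by move=> _ [v _ <-]; exact: l_dist.
have F_linear a g h : intble g -> intble h ->
    F (fun x => a * g x + h x) = a * F g + F h.
  move=> ig ih; apply/eqP; rewrite -subr_eq0 -normr_le0.
  (* Half of the constant pays for approximating the combination, the other half for approximating
     [g] and [h] separately. *)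
  apply: (@ler_mul_gt0P _ _ _ (2 * C * (`|a| + 1))) => [|e e0].
    by rewrite !mulr_ge0// addr_ge0.
  have [u ug] := embedding_dense_integrable ig e0.
  have [v vh] := embedding_dense_integrable ih e0.
  have iagh := integrable_EFin_D (integrable_EFin_Z a ig) ih.
  have d1 := F_dist (a *: u + v) _ iagh.
  have d2 := F_dist u _ ig.
  have d3 := F_dist v _ ih.
  have d4 : dist (a *: u + v) (fun x => a * g x + h x) <=
      `|a| * dist u g + dist v h.
    rewrite -RintegralZl//; last exact: idist.
    have -> : dist (a *: u + v) (fun x => a * g x + h x) =
        \int[mu]_x `|a * (iota u x - g x) + (iota v x - h x)|.
      apply: ae_eq_Rintegral.
      - apply: measurableT_comp => //; apply: integrable_EFin_measurable.
        exact: integrable_EFin_B (iint _) iagh.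
      - apply: measurableT_comp => //; apply: integrable_EFin_measurable.
        apply: integrable_EFin_D; last exact: integrable_EFin_B.
        by apply: integrable_EFin_Z; exact: integrable_EFin_B.
      - apply: filterS (embedding_linear_ae a u v) => x ->.
        by congr `|_|; ring.
    apply: le_RintegralD.
    - apply: integrable_norm; apply: integrable_EFin_D; last exact: integrable_EFin_B.
      by apply: integrable_EFin_Z; exact: integrable_EFin_B.
    - by apply: integrable_EFin_Z; exact: idist.
    - exact: idist.
    - by move=> x; rewrite -normrM ler_normD.
  have d5 : dist (a *: u + v) (fun x => a * g x + h x) <= `|a| * e + e.
    by apply: le_trans d4 _; rewrite lerD ?ler_wpM2l// ltW.
  rewrite add0r (_ : _ - _ = (F (fun x => a * g x + h x) - l (a *: u + v)) -
     (a * (F g - l u) + (F h - l v))); last by rewrite l_lin /=; ring.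
  apply: le_trans (ler_normB _ _) _.
  rewrite (_ : 2 * C * (`|a| + 1) * e =
    C * (`|a| * e + e) + (`|a| * (C * e) + C * e)); last by ring.
  rewrite lerD//; first by apply: le_trans d1 _; rewrite ler_wpM2l.
  apply: le_trans (ler_normD _ _) _; rewrite normrM lerD// ?ler_wpM2l//.
  - by apply: le_trans d2 _; rewrite ler_wpM2l// ltW.
  - by apply: le_trans d3 _; rewrite ler_wpM2l// ltW.
have F_le g : intble g -> `|F g| <= \int[mu]_x (c x * `|g x|).
  (* One [C] comes from replacing [F g] by [l u], the other from replacing [iota u] by [g] in the
     weighted integral. *)
  move=> ig; apply: (@ler_mul_gt0P _ _ _ (2 * C)) => [|e e0].
    by rewrite mulr_ge0.
  have [u ug] := embedding_dense_integrable ig e0.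
  have iu_le : \int[mu]_x (c x * `|iota u x|) <=
      \int[mu]_x (c x * `|g x|) + \int[mu]_x (c x * `|iota u x - g x|).
    apply: le_RintegralD; [exact: ic|exact: ic| |].
    - by apply: ic; exact: integrable_EFin_B.
    - move=> x; rewrite -mulrDr ler_wpM2l//; first by have /andP[] := cC x.
      by apply: le_trans (ler_normD _ _); rewrite addrC subrK.
  have c_dist := c_le _ (integrable_EFin_B (iint u) ig).
  have d1 := F_dist u _ ig; have d2 := l_le u.
  have d3 : C * dist u g <= C * e by rewrite ler_wpM2l// ltW.
  have d4 : `|F g| <= `|F g - l u| + `|l u|.
    by apply: le_trans (ler_normD _ _); rewrite subrK.
  lra.
have [xi [mxi xi_le xiE]] := L1_functional_representation mc cC F_linear F_le.
exists xi; split => // u; rewrite -xiE//; apply/eqP; rewrite eq_sym -subr_eq0 -normr_le0.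
apply: le_trans (F_dist u _ (iint u)) _.
rewrite (_ : dist u (iota u) = 0) ?mulr0//.
by under eq_Rintegral do rewrite subrr normr0; rewrite Rintegral_cst// mul0r.
Qed.

(** The difference [dl] annihilates the range of [iota]. The integrable function [dl * phi] is an
    L^1 limit of elements of that range, and [dl] is bounded, so the integral of [dl ^ 2 * phi] is 0
    with [phi > 0]. *)
Lemma representative_unique (xi xi' : T -> R) (M : R) :
  measurable_fun [set: T] xi -> measurable_fun [set: T] xi' ->
  (forall x, `|xi x| <= M) -> (forall x, `|xi' x| <= M) ->
  (forall u, \int[mu]_x (xi x * iota u x) = \int[mu]_x (xi' x * iota u x)) ->
  {ae mu, forall x, xi x = xi' x}.
Proof.
move=> mxi mxi' xiM xi'M xiE.
have [phi [mphi phi_gt0 iphi]] := sigma_finite_positive_integrable mu.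
pose dl x := xi x - xi' x.
have mdl : measurable_fun [set: T] dl by exact: measurable_funB.
have dlM x : `|dl x| <= M + M.
  by apply: le_trans (ler_normB _ _) _; rewrite lerD.
have idlphi := integrable_EFin_bounded_mul mdl dlM iphi.
have id2 := integrable_EFin_bounded_mul mdl dlM idlphi.
suff : {ae mu, forall x, dl x * (dl x * phi x) = 0}.
  apply: filterS => x /eqP; rewrite !mulf_eq0 (gt_eqF (phi_gt0 x)) orbF orbb.
  by rewrite subr_eq0 => /eqP.
apply: Rintegral_eq0_ae => //.
  by move=> x; rewrite mulrA -expr2 mulr_ge0 ?sqr_ge0// ltW.
(* A point of [T] is what yields [0 <= M]; over an empty [T] the integrand is trivially the constant
   0. *)
have [[x0 _]|noT] := pselect (exists x : T, True); last first.
  rewrite (_ : (fun x => dl x * (dl x * phi x)) = cst 0); last first.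
    by apply/funext => x; exfalso; apply: noT; exists x.
  by rewrite Rintegral_cst// mul0r.
have M0 : 0 <= M by exact: le_trans (xiM x0).
apply/eqP; rewrite -normr_le0; apply: (@ler_mul_gt0P _ _ _ (M + M)) => [|e e0].
  exact: addr_ge0.
have [u ue] := embedding_dense_integrable idlphi e0.
have idlu := integrable_EFin_bounded_mul mdl dlM (iint u).
have dlu0 : \int[mu]_x (dl x * iota u x) = 0.
  under eq_Rintegral do rewrite mulrBl.
  rewrite RintegralB//; first by rewrite xiE subrr.
  - exact: integrable_EFin_bounded_mul mxi xiM (iint u).
  - exact: integrable_EFin_bounded_mul mxi' xi'M (iint u).
rewrite add0r -normrN -[X in `|X|]add0r -dlu0 -RintegralB//.
apply: le_trans (le_normr_Rintegral measurableT (integrable_EFin_B idlu id2)) _.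
have idist := integrable_norm (integrable_EFin_B (iint u) idlphi).
apply: (@le_trans _ _ ((M + M) * dist u (fun x => dl x * phi x))); last first.
  by rewrite ler_wpM2l ?addr_ge0// ltW.
rewrite -RintegralZl//; apply: le_Rintegral => //.
- exact: integrable_norm (integrable_EFin_B idlu id2).
- exact: integrable_EFin_Z.
- by move=> x _; rewrite -mulrBr normrM ler_wpM2r.
Qed.

End dense_embedding.

(** * First-order conditions for the penalized problem *)

Section norm_difference_quotient.
Variable R : realType.
Implicit Types a b : R.

Lemma norm_difference_quotient_le a b n :
  `|n.+1%:R * (`|a + n.+1%:R^-1 * b| - `|a|)| <= `|b|.
Proof.
rewrite normrM ger0_norm// mulrC -ler_pdivlMr//.
apply: le_trans (ler_dist_dist _ _) _.
by rewrite addrAC subrr add0r normrM ger0_norm// mulrC.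
Qed.

(** The sequence is eventually constant: for [a != 0] the perturbed value keeps the sign of [a] once
    the perturbation is smaller than [|a|], and for [a = 0] every term is [|b|]. *)
Lemma cvg_norm_difference_quotient a b :
  n.+1%:R * (`|a + n.+1%:R^-1 * b| - `|a|) @[n --> \oo] -->
    Num.sg a * b + (a == 0)%:R * `|b|.
Proof.
have [->|a0] := eqVneq a 0.
  rewrite sgr0 mul0r add0r mul1r; apply: cvg_near_cst; apply: nearW => n.
  by rewrite add0r normr0 subr0 normrM ger0_norm// mulVKf.
rewrite mul0r addr0; apply: cvg_near_cst.
have cvg0 : n.+1%:R^-1 * b @[n --> \oo] --> (0 : R).
  by rewrite -[0](mul0r b); apply: cvgM; [exact: cvg_harmonic|exact: cvg_cst].
move/cvgrPdist_lt/(_ `|a|) : cvg0; rewrite normr_gt0 => /(_ a0).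
apply: filterS => n; rewrite sub0r normrN ltr_norml => /andP[lt1 lt2].
have [a_gt0|a_lt0|/eqP] := ltgtP 0 a; last by rewrite eq_sym (negbTE a0).
  rewrite (gtr0_norm a_gt0) in lt1 lt2 *.
  rewrite gtr0_sg// mul1r ger0_norm; last by rewrite -lerBlDl sub0r ltW.
  by rewrite addrAC subrr add0r mulVKf.
rewrite (ltr0_norm a_lt0) in lt1 lt2 *.
rewrite ltr0_sg// mulN1r ler0_norm; last by rewrite -lerBrDl sub0r ltW.
by rewrite opprK opprD addrAC addNr add0r mulrN mulVKf.
Qed.

End norm_difference_quotient.

(** * The largest-K norm *)

Section largestK_theory.
Context d (T : measurableType d) (R : realType).
Variable mu : {measure set T -> \bar R}.
Implicit Types g h : T -> R.
Local Notation intble g := (mu.-integrable [set: T] (EFin \o g)).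

Lemma le_largestK K g B : intble g -> measurable B -> (mu B <= K%:E)%E ->
  \int[mu]_(x in B) `|g x| <= largestK mu K g.
Proof.
move=> ig mB BK; apply: ub_le_sup; last by exists B.
exists (\int[mu]_x `|g x|) => _ [D [mD _] <-].
rewrite -Rintegral_indic_mul; apply: le_Rintegral => //.
- exact/integrable_indic_mul/integrable_norm.
- exact: integrable_norm.
- by move=> x _; rewrite ler_piMl// indicE lern1 leq_b1.
Qed.

Lemma ae_eq_largestK K g h : measurable_fun [set: T] g -> measurable_fun [set: T] h ->
  {ae mu, forall x, g x = h x} -> largestK mu K g = largestK mu K h.
Proof.
move=> mg mh gh; congr sup; apply: eq_imagel => B [mB _].
rewrite -2!(Rintegral_indic_mul mu B); apply: ae_eq_Rintegral.
- apply: measurable_funM; first exact: measurable_indic.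
  exact: measurableT_comp.
- apply: measurable_funM; first exact: measurable_indic.
  exact: measurableT_comp.
- by apply: filterS gh => x ->.
Qed.

End largestK_theory.

Lemma bounded_scalar_continuous (R : realType) (X : normedModType R)
    (s : X -> R) (C : R) :
  0 <= C -> scalar s -> (forall v, `|s v| <= C * `|v|) -> continuous s.
Proof.
move=> C0 s_lin s_le v; apply/cvgrPdist_lt => e e0.
have C1 : 0 < C + 1 by rewrite ltr_wpDl.
have : \forall v' \near v, `|v - v'| < e / (C + 1).
  by have /cvgrPdist_lt/(_ _ (divr_gt0 e0 C1)) := @cvg_id _ (nbhs v).
apply: filterS => v'; rewrite ltr_pdivlMr// => lte.
rewrite -scalar_functionalB//; apply: le_lt_trans (s_le _) _; apply: le_lt_trans lte.
by rewrite mulrC ler_wpM2l// lerDl.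
Qed.

Lemma cvg_gateaux_quotient (R : realType) (X : normedModType R)
    (f : X -> R) (u z : X) :
  derivable f u z ->
  n.+1%:R * (f (u + n.+1%:R^-1 *: z) - f u) @[n --> \oo] --> gateaux_deriv f u z.
Proof.
move=> /= df.
(* The derivative is a limit over punctured neighbourhoods of 0, so the sequence of steps must also
   avoid 0. *)
have t0 : (n.+1%:R^-1 : R) @[n --> \oo] --> (0 : R)^'.
  move=> P P0.
  have : \forall n \near \oo, (harmonic n : R) != 0 -> P (harmonic n).
    exact: cvg_harmonic P0.
  by apply: filterS => n; apply; exact: lt0r_neq0 (harmonic_gt0 n).
have := cvg_comp _ _ t0 df.
apply: cvg_trans; apply: near_eq_cvg; apply: nearW => n /=.
by rewrite invrK [u + _]addrC.
Qed.

(** * From the optimality condition to an explicit representative of the derivative *)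

Section critical_points.
Context d (T : measurableType d) (R : realType).
Variables (mu : {sigma_finite_measure set T -> \bar R}) (K rho : R).
Variables (X : normedModType R) (iota : X -> LspaceType1 mu).
Hypothesis rho_gt0 : 0 < rho.
Hypothesis iotaP : compact_dense_embedding iota.
Variables (f : X -> R) (ustar : X) (w : T -> R).
Hypothesis f_gateaux : gateaux_differentiable f.
Hypothesis ustarP :
  local_min (fun u => f u +
    rho * (L1norm mu (iota u) - largestK mu K (iota u))) ustar \/
  strongly_critical (fun u => f u + rho * L1norm mu (iota u))
    (fun u => rho * largestK mu K (iota u)) ustar.
Hypothesis w_meas : measurable_fun [set: T] w.
Hypothesis w_rep : w = iota ustar %[ae mu].

Local Notation intble g := (mu.-integrable [set: T] (EFin \o g)).

Let iint u : intble (iota u) := LspaceType1_integrable (iota u).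
Let miota u : measurable_fun [set: T] (iota u) := integrable_EFin_measurable (iint u).

Let w_ae : {ae mu, forall x, w x = iota ustar x}.
Proof. by apply: filterS w_rep => x /(_ Logic.I). Qed.

Let sg_norm x : `|Num.sg (w x)| <= 1.
Proof. by rewrite normr_sg lern1 leq_b1. Qed.

Let msg : measurable_fun [set: T] (fun x => Num.sg (w x)).
Proof.
have -> : (fun x => Num.sg (w x)) =
    (fun x => \1_[set y | cst 0 y < w y] x - \1_[set y | w y < cst 0 y] x).
  apply/funext => x; rewrite !indicE /cst.
  have [w0|w0|w0] := ltgtP 0 (w x).
  - by rewrite gtr0_sg// mem_set// memNset ?subr0//= => /(lt_trans w0); rewrite ltxx.
  - rewrite ltr0_sg// [in X in _ - X]mem_set// memNset ?sub0r//=.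
    by move=> /(lt_trans w0); rewrite ltxx.
  - by rewrite -w0 sgr0 !memNset ?subr0//= -w0 ltxx.
by apply: measurable_funB; apply: measurable_indic; exact: measurable_set_lt.
Qed.

(** Both alternatives of [ustarP] are merged here. For a local minimum, the increment of
    [f + rho * L1norm] dominates that of [rho * largestK], hence [s], as soon as the step stays in
    the neighbourhood; for a strongly critical point, [s] is itself a subgradient of the first
    term. *)
Lemma strongly_critical_inequality s :
  subdifferential (fun u => rho * largestK mu K (iota u)) ustar s ->
  forall z, \forall n \near \oo,
    n.+1%:R^-1 * s z <= f (ustar + n.+1%:R^-1 *: z) - f ustar +
      rho * (L1norm mu (iota (ustar + n.+1%:R^-1 *: z)) - L1norm mu (iota ustar)).
Proof.
move=> s_sub z.
have [[s_lin _] s_le] := s_sub.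
have sZ t : s (ustar + t *: z - ustar) = t * s z.
  by rewrite addrAC subrr add0r scalar_functionalZ.
case: ustarP => [u_min|[_ /(_ _ s_sub)[_ s_le']]].
- have cvgu : ustar + n.+1%:R^-1 *: z @[n --> \oo] --> ustar.
    have cvg0 : n.+1%:R^-1 *: z @[n --> \oo] --> 0 *: z.
      by have := cvgZr_tmp (a := z) (@cvg_harmonic R); apply.
    have := cvgD (cvg_cst ustar) cvg0; rewrite scale0r addr0; exact.
  pose g u := f u + rho * (L1norm mu (iota u) - largestK mu K (iota u)).
  have : \forall n \near \oo, g ustar <= g (ustar + n.+1%:R^-1 *: z).
    exact: cvgu u_min.
  apply: filterS => n; rewrite /g => u_le.
  have := s_le (ustar + n.+1%:R^-1 *: z); rewrite sZ /=.
  set v := ustar + _ in u_le *; move: (_ * s z) => r; lra.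
- apply: nearW => n.
  have := s_le' (ustar + n.+1%:R^-1 *: z); rewrite sZ /=.
  set v := ustar + _; move: (_ * s z) => r; lra.
Qed.

(** The inequality along steps [n.+1%:R^-1] is multiplied by [n.+1%:R] and passed to the limit: the
    quotient of [f] converges by Gateaux differentiability, that of the norm by dominated
    convergence under [|iota z|]. *)
Lemma subdifferential_le_derivative s :
  subdifferential (fun u => rho * largestK mu K (iota u)) ustar s ->
  forall z, s z <= gateaux_deriv f ustar z +
    rho * \int[mu]_x (Num.sg (w x) * iota z x + (w x == 0)%:R * `|iota z x|).
Proof.
move=> s_sub z.
have mq n : measurable_fun [set: T]
    (fun x => n.+1%:R * (`|w x + n.+1%:R^-1 * iota z x| - `|w x|)).
  apply: measurable_funM => //; apply: measurable_funB.
    apply: measurableT_comp => //; apply: measurable_funD => //.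
    by apply: measurable_funM => //; exact: miota.
  exact: measurableT_comp.
have mlim : measurable_fun [set: T]
    (fun x => Num.sg (w x) * iota z x + (w x == 0)%:R * `|iota z x|).
  apply: (measurable_fun_cvg mq) => x _; exact: cvg_norm_difference_quotient.
have [_ _ cvg_norm] := Rintegral_dominated_cvg mq mlim
  (fun x => @cvg_norm_difference_quotient R (w x) (iota z x))
  (integrable_norm (iint z))
  (fun n x => norm_difference_quotient_le (w x) (iota z x) n).
pose I_ n := \int[mu]_x (n.+1%:R * (`|w x + n.+1%:R^-1 * iota z x| - `|w x|)).
pose I := \int[mu]_x (Num.sg (w x) * iota z x + (w x == 0)%:R * `|iota z x|).
have cvg_f := cvg_gateaux_quotient ((f_gateaux ustar).1 z).
have cvg_rho : rho * I_ n @[n --> \oo] --> rho * I.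
  by apply: cvgM; [exact: cvg_cst|exact: cvg_norm].
apply: (cvgr_to_ge (@cvgD R R _ _ _ _ _ _ _ cvg_f cvg_rho)).
apply: filterS (strongly_critical_inequality s_sub z) => n s_le.
suff : s z <= n.+1%:R * (f (ustar + n.+1%:R^-1 *: z) - f ustar) + rho * I_ n by [].
have -> : I_ n =
    n.+1%:R * (L1norm mu (iota (ustar + n.+1%:R^-1 *: z)) - L1norm mu (iota ustar)).
  rewrite !L1normE -RintegralB//; [|exact: integrable_norm..].
  rewrite -RintegralZl//; last by apply: integrable_EFin_B; exact: integrable_norm.
  apply: ae_eq_Rintegral => //.
    apply: measurable_funM => //.
    by apply: measurable_funB; apply: measurableT_comp.
  apply: filterS2 w_ae (embedding_linear_ae iotaP n.+1%:R^-1 z ustar) => x ->.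
  by rewrite [ustar + _]addrC => ->; rewrite [iota ustar x + _]addrC.
rewrite mulrCA -mulrDr -ler_pdivrMl//.
Qed.

Section support_set.
Variable A : set T.
Hypotheses (A_meas : measurable A) (A_le : (mu A <= K%:E)%E)
  (A_max : \int[mu]_(x in A) `|w x| = largestK mu K w).

Let s v := rho * \int[mu]_x (\1_A x * (Num.sg (w x) * iota v x)).

Let isg v : intble (fun x => Num.sg (w x) * iota v x).
Proof. exact: integrable_EFin_bounded_mul msg sg_norm (iint v). Qed.

Let iAsg v : intble (fun x => \1_A x * (Num.sg (w x) * iota v x)).
Proof. exact: integrable_indic_mul. Qed.

Let s_linear : scalar s.
Proof.
move=> a u v; rewrite /s mulrCA -mulrDr -(@RintegralZl _ _ _ _ _ _ a)// -RintegralD//.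
  congr (_ * _); apply: ae_eq_Rintegral.
  - exact: integrable_EFin_measurable (iAsg _).
  - exact: integrable_EFin_measurable
      (integrable_EFin_D (integrable_EFin_Z a (iAsg u)) (iAsg v)).
  - by apply: filterS (embedding_linear_ae iotaP a u v) => x ->; ring.
exact: integrable_EFin_Z.
Qed.

Let indic_sg_le v x : `|\1_A x * (Num.sg (w x) * iota v x)| <= `|\1_A x * iota v x|.
Proof. by rewrite !normrM ler_wpM2l// ler_piMl. Qed.

Let indic_normE v : \int[mu]_x `|\1_A x * iota v x| = \int[mu]_(x in A) `|iota v x|.
Proof.
rewrite -[RHS]Rintegral_indic_mul; apply: eq_Rintegral => x _.
by rewrite normrM indicE normr_nat.
Qed.

Let s_le v : `|s v| <= rho * \int[mu]_(x in A) `|iota v x|.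
Proof.
rewrite /s normrM (gtr0_norm rho_gt0) ler_pM2l//.
apply: le_trans (le_normr_Rintegral measurableT (iAsg v)) _.
rewrite -indic_normE; apply: le_Rintegral => //.
- exact: integrable_norm (iAsg v).
- exact: integrable_norm (integrable_indic_mul A_meas (iint v)).
Qed.

(** [s v] is at most [rho * largestK] of [iota v] for every [v], with equality at [ustar] because
    [A] attains the supremum and [sgn(w) * w = |w|]; for a linear [s] this is the subgradient
    inequality. *)
Let s_subdifferential :
  subdifferential (fun u => rho * largestK mu K (iota u)) ustar s.
Proof.
have mK v : \int[mu]_(x in A) `|iota v x| <= largestK mu K (iota v).
  exact: le_largestK.
split; first split; first exact: s_linear.
  have [C C_le] := embedding_continuous iotaP.
  apply: (@bounded_scalar_continuous _ _ _ (rho * `|C|)) => [|//|v].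
    by rewrite mulr_ge0// ltW.
  apply: le_trans (s_le v) _; rewrite -mulrA ler_pM2l//.
  apply: (@le_trans _ _ (L1norm mu (iota v))).
    rewrite L1normE -indic_normE; apply: le_Rintegral => //.
    - exact: integrable_norm (integrable_indic_mul A_meas (iint v)).
    - exact: integrable_norm (iint v).
    - by move=> x _; rewrite normrM ler_piMl// indicE normr_nat lern1 leq_b1.
  by apply: le_trans (C_le v) _; rewrite ler_wpM2r// ler_norm.
move=> v; rewrite scalar_functionalB// lerB//.
  apply: le_trans (ler_norm _) _; apply: le_trans (s_le v) _.
  by rewrite ler_pM2l.
rewrite ler_pM2l// -(ae_eq_largestK _ w_meas (miota ustar) w_ae) -A_max.
rewrite -Rintegral_indic_mul le_eqVlt; apply/orP; left; apply/eqP.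
apply: ae_eq_Rintegral.
- apply: measurable_funM; first exact: measurable_indic.
  exact: measurableT_comp.
- exact: integrable_EFin_measurable (iAsg _).
- by apply: filterS w_ae => x <-; rewrite -normrEsg.
Qed.

Lemma structured_representative : exists xi : T -> R,
  [/\ measurable_fun [set: T] xi, forall x, `|xi x| <= rho,
      forall v, gateaux_deriv f ustar v = \int[mu]_x (xi x * iota v x),
      forall x, (supp w `&` A) x -> xi x = 0 &
      forall x, (supp w `\` A) x -> xi x = - rho * Num.sg (w x)].
Proof.
have [_ [f'_lin _]] := f_gateaux ustar.
pose N := ~` supp w.
have NE x : \1_N x = (w x == 0)%:R :> R.
  rewrite indicE; have [w0|w0] := eqVneq (w x) 0.
    by rewrite mem_set// /N /supp/= w0 eqxx.
  by rewrite memNset// => /(_ w0).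
have mN : measurable N.
  (* The square of the sign is the indicator of the support, which reduces measurability of [N] to
     that of the sign. *)
  apply/(measurable_indicP R); rewrite (_ : \1_N = fun x => 1 - Num.sg (w x) ^+ 2).
    by apply: measurable_funB => //; exact: measurable_funX.
  apply/funext => x; rewrite NE sqr_sg; by case: eqP; rewrite ?subr0 ?subrr.
pose l v := gateaux_deriv f ustar v - s v +
  rho * \int[mu]_x (Num.sg (w x) * iota v x).
have l_lin : scalar l.
  move=> a u v; rewrite /l f'_lin s_linear.
  have -> : \int[mu]_x (Num.sg (w x) * iota (a *: u + v) x) =
      a * \int[mu]_x (Num.sg (w x) * iota u x) + \int[mu]_x (Num.sg (w x) * iota v x).
    rewrite -RintegralZl// -RintegralD//; last exact: integrable_EFin_Z.
    apply: ae_eq_Rintegral.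
    - exact: integrable_EFin_measurable (isg _).
    - exact: integrable_EFin_measurable
        (integrable_EFin_D (integrable_EFin_Z a (isg u)) (isg v)).
    - by apply: filterS (embedding_linear_ae iotaP a u v) => x ->; ring.
  by rewrite /=; ring.
pose c x := rho * \1_N x.
have mc : measurable_fun [set: T] c.
  by apply: measurable_funM => //; exact: measurable_indic.
have crho x : 0 <= c x <= rho.
  have rho_ge0 := ltW rho_gt0.
  by rewrite /c mulr_ge0//= ler_piMr// indicE lern1 leq_b1.
have c_ge0 x : 0 <= c x by have /andP[] := crho x.
have ic v : intble (fun x => c x * `|iota v x|).
  apply: (@integrable_EFin_bounded_mul _ _ _ _ rho) => //.
    by move=> x; rewrite ger0_norm//; have /andP[] := crho x.
  exact: integrable_norm (iint v).
(* This is the derivative inequality for [s], with the sign term moved into [l] and the term on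
   [w = 0] written with the weight [c]. *)
have l_ge v : - l v <= \int[mu]_x (c x * `|iota v x|).
  have := subdifferential_le_derivative s_subdifferential v.
  have -> : rho * \int[mu]_x (Num.sg (w x) * iota v x + (w x == 0)%:R * `|iota v x|) =
      rho * \int[mu]_x (Num.sg (w x) * iota v x) + \int[mu]_x (c x * `|iota v x|).
    rewrite -!RintegralZl//; last first.
      apply: integrable_EFin_D => //.
      under eq_fun do rewrite -NE.
      exact: integrable_indic_mul mN (integrable_norm (iint v)).
    rewrite -RintegralD//; last exact: integrable_EFin_Z.
    by apply: eq_Rintegral => x _; rewrite /c NE; ring.
  rewrite /l; lra.
have l_le v : `|l v| <= \int[mu]_x (c x * `|iota v x|).
  rewrite ler_norml; apply/andP; split; first by rewrite lerNl.
  have := l_ge (- v); rewrite scalar_functionalN// opprK => /le_trans; apply.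
  rewrite le_eqVlt; apply/orP; left; apply/eqP; apply: ae_eq_Rintegral.
  - exact: integrable_EFin_measurable (ic _).
  - exact: integrable_EFin_measurable (ic _).
  (* Linearity of [iota] holds only almost everywhere: the second instance gives [iota 0 = 0], after
     which the first gives [iota (- v) = - iota v]. *)
  - apply: filterS2 (embedding_linear_ae iotaP (-1) v 0)
      (embedding_linear_ae iotaP (-1) 0 0) => x.
    rewrite !scaler0 !addr0 scaleN1r !mulN1r addNr => -> ->.
    by rewrite addr0 normrN.
have [xi0 [mxi0 xi0_le xi0E]] :=
  functional_representation iotaP mc (ltW rho_gt0) crho l_lin l_le.
have xi0_supp x : supp w x -> xi0 x = 0.
  move=> wx; apply/eqP; rewrite -normr_le0; apply: le_trans (xi0_le x) _.
  by rewrite /c NE (negbTE wx) mulr0.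
have mA : measurable_fun [set: T] (\1_A : T -> R) by exact: measurable_indic.
(* Solving the definition of [l] for the derivative gives this formula; [xi0] vanishes on the
   support, where only [- rho * sgn(w)] off [A] survives. *)
pose xi x := xi0 x + rho * (\1_A x * Num.sg (w x)) - rho * Num.sg (w x).
have xi_A x : (supp w `&` A) x -> xi x = 0.
  by move=> [wx Ax]; rewrite /xi xi0_supp// indicE mem_set// add0r mul1r subrr.
have xi_nA x : (supp w `\` A) x -> xi x = - rho * Num.sg (w x).
  move=> [wx Ax].
  by rewrite /xi xi0_supp// indicE memNset// mul0r mulr0 !add0r mulNr.
have ixi0 v : intble (fun x => xi0 x * iota v x).
  apply: (@integrable_EFin_bounded_mul _ _ _ _ rho) (iint v) => // x.
  by apply: le_trans (xi0_le x) _; have /andP[] := crho x.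
exists xi; split => //.
- apply: measurable_funB; last by apply: measurable_funM.
  by apply: measurable_funD => //; apply: measurable_funM => //; apply: measurable_funM.
- move=> x; have [wx|wx] := pselect (supp w x); last first.
    have w0 : w x = 0 by apply/eqP; apply: contrapT => /negP.
    rewrite /xi w0 sgr0 !mulr0 subr0 addr0; apply: le_trans (xi0_le x) _.
    by have /andP[] := crho x.
  have [Ax|Ax] := pselect (A x); first by rewrite xi_A// normr0 ltW.
  by rewrite xi_nA// mulNr normrN normrM gtr0_norm// ler_piMr// ltW.
- move=> v.
  have -> : gateaux_deriv f ustar v =
      l v + s v - rho * \int[mu]_x (Num.sg (w x) * iota v x) by rewrite /l; ring.
  rewrite xi0E /s -!RintegralZl// -RintegralD//; last exact: integrable_EFin_Z.
  rewrite -RintegralB//; last 2 first.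
  - exact/integrable_EFin_D/integrable_EFin_Z.
  - exact: integrable_EFin_Z.
  by apply: eq_Rintegral => x _; rewrite /xi; ring.
Qed.

End support_set.
End critical_points.

(** * Pointwise description of the derivative and uniqueness of the maximizing set *)

Theorem theorem5p7 (R : realType) (d : measure_display) (T : measurableType d)
    (mu : {sigma_finite_measure set T -> \bar R}) (K rho : R)
    (K_gt0 : 0 < K) (K_lt : (K%:E < mu [set: T])%E) (rho_gt0 : 0 < rho)
    (X : completeNormedModType R) (X_reflexive : reflexive_space X)
    (iota : X -> LspaceType1 mu) (iotaP : compact_dense_embedding iota)
    (f : X -> R)
    (f_lsc : lower_semicontinuous (EFin \o f))
    (f_convex : convex_function [set: X] f)
    (f_bounded_below : has_lbound (range f))
    (f_coercive : coercive f)
    (f_gateaux : gateaux_differentiable f)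
    (ustar : X)
    (ustarP :
       local_min (fun u => f u +
         rho * (L1norm mu (iota u) - largestK mu K (iota u))) ustar \/
       strongly_critical (fun u => f u + rho * L1norm mu (iota u))
         (fun u => rho * largestK mu K (iota u)) ustar)
    (w : T -> R) (w_meas : measurable_fun [set: T] w)
    (w_rep : w = iota ustar %[ae mu])
    (A : set T) (A_meas : measurable A) (A_supp : A `<=` supp w)
    (A_le : (mu A <= K%:E)%E)
    (A_max : \int[mu]_(x in A) `|w x| = largestK mu K w) :
  [/\ exists xi : T -> R,
        Linfty_representative iota (gateaux_deriv f ustar) xi,
      forall xi : T -> R,
        Linfty_representative iota (gateaux_deriv f ustar) xi ->
        [/\ {ae mu, forall x, (supp w `&` A) x -> xi x = 0},
            {ae mu, forall x, (supp w `\` A) x -> xi x = - rho * Num.sg (w x)}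
          & {ae mu, forall x, ~ supp w x -> `|xi x| <= rho}]
    & forall B : set T, measurable B -> B `<=` supp w ->
        (mu B <= K%:E)%E ->
        \int[mu]_(x in B) `|w x| = largestK mu K w ->
        mu (A `+` B) = 0%E].
Proof.
have rho_norm (xi : T -> R) : (forall x, `|xi x| <= rho) ->
    forall M x, `|xi x| <= Num.max M rho.
  by move=> xi_le M x; rewrite le_max xi_le orbT.
have [xi [mxi xi_le xiE xi_A xi_nA]] := structured_representative rho_gt0 iotaP
  f_gateaux ustarP w_meas w_rep A_meas A_le A_max.
split.
- by exists xi; split => //; exact: bounded_Lfun_infty mxi xi_le.
- move=> zeta [zeta_Lfun zetaE].
  have mu_gt0 : (0 < mu [set: T])%E.
    by apply: lt_trans K_lt; rewrite lte_fin.
  have [mzeta [M zeta_le]] := Lfun_infty_bounded mu_gt0 zeta_Lfun.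
  pose N := Num.max M rho.
  have N_gt0 : 0 < N by rewrite lt_max rho_gt0 orbT.
  (* An arbitrary representative is only essentially bounded, whereas uniqueness asks for a bound at
     every point, shared with [xi]: hence the truncation at [N], the larger of [M] and [rho]. *)
  pose zeta' x := Num.max (- N) (Num.min N (zeta x)).
  have mzeta' : measurable_fun [set: T] zeta'.
    by apply: measurable_maxr => //; exact: measurable_minr.
  have zeta'_le x : `|zeta' x| <= N.
    rewrite ler_norml /zeta' le_max lexx/= ge_max ge_min lexx/= andbT.
    by rewrite (le_trans _ (ltW N_gt0))// oppr_le0 ltW.
  have zeta'E : {ae mu, forall x, zeta' x = zeta x}.
    apply: filterS zeta_le => x zeta_leM; rewrite /zeta'.
    have : `|zeta x| <= N by rewrite le_max zeta_leM.
    by rewrite ler_norml => /andP[? ?]; rewrite min_r// max_r.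
  have zeta_xi : {ae mu, forall x, zeta x = xi x}.
    suff : {ae mu, forall x, zeta' x = xi x}.
      by apply: filterS2 zeta'E => x ->.
    apply: (representative_unique iotaP mzeta' mxi zeta'_le (rho_norm _ xi_le M)) => u.
    rewrite -xiE zetaE; have iu := LspaceType1_integrable (iota u).
    have miu := integrable_EFin_measurable iu.
    apply: ae_eq_Rintegral; [exact: measurable_funM|exact: measurable_funM|].
    by apply: filterS zeta'E => x ->.
  split; apply: filterS zeta_xi => x ->; [exact: xi_A|exact: xi_nA|by []].
- move=> B B_meas B_supp B_le B_max.
  have [zeta [mzeta zeta_le zetaE zeta_B zeta_nB]] := structured_representative
    rho_gt0 iotaP f_gateaux ustarP w_meas w_rep B_meas B_le B_max.
  (* The representatives built from [A] and from [B] agree off a null set [N], which is shown to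
     contain the symmetric difference. *)
  have [N [mN N0 N_sub]] : {ae mu, forall x, xi x = zeta x}.
    by apply: (representative_unique iotaP mxi mzeta xi_le zeta_le) => u; rewrite -xiE.
  apply: (subset_measure0 _ mN _ N0); first by apply: measurableU; exact: measurableD.
  have sg_neq0 x : supp w x -> - rho * Num.sg (w x) <> 0.
    by move=> wx /eqP; rewrite mulf_eq0 oppr_eq0 sgr_eq0 (gt_eqF rho_gt0) (negbTE wx).
  (* Where only one of the two sets contains [x], one representative is 0 and the other is
     [- rho * sgn(w)], nonzero because both sets lie in the support. *)
  move=> x [[Ax Bx]|[Bx Ax]]; apply: N_sub => /= xi_zeta.
  + have wx := A_supp _ Ax; apply: (sg_neq0 _ wx).
    by rewrite -(zeta_nB x)// -xi_zeta xi_A.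
  + have wx := B_supp _ Bx; apply: (sg_neq0 _ wx).
    by rewrite -(xi_nA x)// xi_zeta zeta_B.
Qed.
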